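(* Let $\mathcal{F}$ be any of the following classes of functions $\mathbb{R}\to\mathbb{R}$: the trigonometric polynomials; the continuous functions $C(\mathbb{R})$; the Lipschitz functions; $C^n(\mathbb{R})$ (for a positive integer $n$); $C^\infty(\mathbb{R})$; the real analytic functions; the derivatives; the approximately continuous functions. Then $\mathrm{sc}(\mathcal{F})=\omega_1$. Moreover, for each of these classes $\mathcal{F}$, also $\mathrm{sc}(\{f\in\mathcal{F}: f\text{ is bounded}\})=\omega_1$.
   Context: A trigonometric polynomial is a function of the form $a_0+\sum_{k=1}^m (a_k\cos 2\pi kx+b_k\sin 2\pi kx)$ with real coefficients. A derivative is a function $f:\mathbb{R}\to\mathbb{R}$ such that $f=F'$ for some everywhere differentiable $F:\mathbb{R}\to\mathbb{R}$. A function $f:\mathbb{R}\to\mathbb{R}$ is approximately continuous if for every $x\in\mathbb{R}$ there is a Lebesgue measurable set $E\ni x$ having Lebesgue density $1$ at $x$ such that $f|_E$ is continuous at $x$. $\mathbb{R}^{\mathbb{R}}$ is the set of all functions $f:\mathbb{R}\to\mathbb{R}$. A difference operator is a map $D:\mathbb{R}^{\mathbb{R}}\to\mathbb{R}^{\mathbb{R}}$ of the form $(Df)(x)=\sum_{i=1}^n a_i f(x+b_i)$ with $a_i,b_i\in\mathbb{R}$; $\mathcal{D}$ is the set of difference operators. A system of difference equations is a set $S\subset\mathcal{D}\times\mathbb{R}^{\mathbb{R}}$; a function $f:\mathbb{R}\to\mathbb{R}$ is a solution to $S$ if $Df=g$ for every $(D,g)\in S$. A subsystem of $S$ is a subset of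 $S$. For $\mathcal{F}\subset\mathbb{R}^{\mathbb{R}}$ the solvability cardinal $\mathrm{sc}(\mathcal{F})$ is the minimal cardinal $\kappa$ with the following property: for every system $S$ of difference equations, if every subsystem of $S$ of cardinality less than $\kappa$ has a solution in $\mathcal{F}$, then $S$ has a solution in $\mathcal{F}$. *)

(* Defs.v *)
From HB Require Import structures.
From mathcomp Require Import all_boot all_order all_algebra.
From mathcomp Require Import all_classical all_reals all_analysis.
From mathcomp Require Import measurable_realfun.

Set Implicit Arguments.
Unset Strict Implicit.
Unset Printing Implicit Defensive.

Import Order.TTheory GRing.Theory Num.Theory.
Import numFieldNormedType.Exports.

Local Open Scope classical_set_scope.
Local Open Scope card_scope.
Local Open Scope ring_scope.

(* A cardinal is represented by any type having that cardinality; all the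
   notions below depend on the type only up to equipotence. *)

Definition card_lt T U (A : set T) (B : set U) : Prop :=
  A #<= B /\ ~ (B #<= A).

Definition is_omega1 (W : Type) : Prop :=
  ~ countable [set: W] /\
  forall U : Type, ~ countable [set: U] -> [set: W] #<= [set: U].

Section solvability.
Variable R : realType.

Definition difference_operator (D : (R -> R) -> (R -> R)) : Prop :=
  exists (n : nat) (a b : 'I_n -> R),
    D = fun f x => \sum_(i < n) a i * f (x + b i).

Definition difference_system (S : set (((R -> R) -> (R -> R)) * (R -> R))) :
    Prop :=
  forall D g, S (D, g) -> difference_operator D.

Definition solution (S : set (((R -> R) -> (R -> R)) * (R -> R)))
    (f : R -> R) : Prop :=
  forall D g, S (D, g) -> D f = g.

Definition solvable_in (F : set (R -> R))
    (S : set (((R -> R) -> (R -> R)) * (R -> R))) : Prop :=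
  exists2 f, F f & solution S f.

Definition solvability_property (F : set (R -> R)) (K : Type) : Prop :=
  forall S, difference_system S ->
    (forall S', S' `<=` S -> card_lt S' [set: K] -> solvable_in F S') ->
    solvable_in F S.

(* "K is the solvability cardinal sc(F)" *)
Definition is_sc (F : set (R -> R)) (K : Type) : Prop :=
  solvability_property F K /\
  forall K' : Type, solvability_property F K' -> [set: K] #<= [set: K'].

End solvability.

Section function_classes.
Variable R : realType.

Definition trig_polynomials : set (R -> R) :=
  [set f : R -> R | exists (m : nat) (a b : nat -> R), f = fun x =>
     a 0%N + \sum_(1 <= k < m.+1) (a k * cos (2 * pi * k%:R * x)
                                   + b k * sin (2 * pi * k%:R * x))].

Definition continuous_functions : set (R -> R) := [set f : R -> R | continuous f].

Definition lipschitz_functions : set (R -> R) := [set f : R -> R | lipschitz f].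

(* [derive1n] is total, so differentiability is required at every order. *)
Definition C_ (n : nat) : set (R -> R) :=
  [set f : R -> R | (forall k x, (k < n)%N -> derivable (derive1n k f) x 1) /\
           continuous (derive1n n f)].

Definition C_infty : set (R -> R) := [set f : R -> R | forall n, C_ n f].

Definition real_analytic_functions : set (R -> R) :=
  [set f : R -> R | forall x0 : R, exists (a : nat -> R) (r : R), 0 < r /\
     forall x, `|x - x0| < r -> pseries a (x - x0) @ \oo --> f x].

Definition derivatives : set (R -> R) :=
  [set f : R -> R | exists G : R -> R, forall x : R, is_derive x 1 G (f x)].

Definition lebesgue_measurable (E : set R) : Prop :=
  (completed_algebra_gen (@lebesgue_measure R)).-sigma.-measurable E.

Definition density_one_at (E : set R) (x : R) : Prop :=
  (completed_lebesgue_measure (E `&` ball x r)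
     * (completed_lebesgue_measure (ball x r))^-1)%E @[r --> 0^'+] --> 1%E.

Definition approximately_continuous_functions : set (R -> R) :=
  [set f : R -> R | forall x : R, exists E : set R,
     [/\ lebesgue_measurable E, E x, density_one_at E x &
         f @ within E (nbhs x) --> f x]].

Definition bounded_functions : set (R -> R) := bounded_fun.

End function_classes.

(* Main.v *)
Require Import Defs.
From mathcomp Require Import all_boot all_order all_algebra.
From mathcomp Require Import all_classical all_reals all_analysis.
From mathcomp Require Import wochoice measurable_realfun ring lra.

(** Let [F] be one of the classes.

    Upper bound.  The classes are small topological spaces: there are countably
    many sets of functions such that, whenever [f] in [F] does not solve an
    equation [Df = g] that is solvable in [F], one of these sets contains [f] and
    no solution in [F] ([countably_separated]).  Choosing for each of these
    sets an equation excluding it, if there is one, yields a countable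
    subsystem all of whose solutions solve the whole system
    ([solvability_property_omega1]).  All the classes except the derivatives
    consist of approximately continuous functions, so it suffices to separate
    these ([approximately_continuous_countably_separated]).  Here the sets of
    the family prescribe, up to a rational error, the values of a function on
    most of the points of finitely many rational intervals; at points near [x]
    this determines [Df] up to a small error with few exceptions, while [g],
    being the image by [D] of a function of the class, stays close to [g(x)]
    with few exceptions.  A derivative is replaced with its antiderivative,
    which is continuous and satisfies the equation up to a constant
    ([derivatives_countably_separated]).

    Lower bound.  It remains to find one system without solution in any of the
    classes, whose finite subsystems are solved by bounded functions belonging
    to all the classes ([solvability_property_uncountable]).  Take the equations
    [f(x + 2^-n) - f(x) = T_n(x + 2^-n) - T_n(x)], where [T_n] is the sum for
    [k < n] of [2 pi 32^k cos(2 pi 2^k x)].  The terms with [k >= n] have period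
    [2^-n], so the trigonometric polynomial [T_N] satisfies all the equations
    with [n <= N].  On the other hand a function that is approximately continuous
    at [0] has small increments between most nearby points, whereas the term
    [k = n - 1] makes the increments of [T_n] huge
    ([lacunary_increments_unsolvable]).  For a derivative the same argument
    applies to an antiderivative.

    The first uncountable cardinal itself is represented by the elements having
    countably many predecessors in a well-ordering of an uncountable set. *)

Set Implicit Arguments.
Unset Strict Implicit.
Unset Printing Implicit Defensive.

Import Order.TTheory GRing.Theory Num.Theory.
Import numFieldNormedType.Exports.

Local Open Scope classical_set_scope.
Local Open Scope card_scope.
Local Open Scope ring_scope.

(** * The first uncountable cardinal *)

Lemma uncountable_set_nat : ~ countable [set: set nat].
Proof.
move=> /countable_injP[f finj].
pose D : set nat := [set n | exists2 A, f A = n & ~ A n].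
have fI A B : f A = f B -> A = B by apply: finj; rewrite inE.
have [DfD|nDfD] := pselect (D (f D)).
  by case: (DfD) => A /fI ->.
by apply: (nDfD); exists D.
Qed.

Section first_uncountable.
Variables (T : choiceType) (r : rel T).
Hypothesis r_wo : well_order r.

Let below (x : T) : set T := [set y | r y x /\ y <> x].

Let has_min (A : set T) : A !=set0 -> exists2 z, A z & forall y, A y -> r z y.
Proof.
move=> [x Ax].
have [|z [[/asboolP Az zA] _]] := @r_wo (fun y => `[< A y >]).
  by exists x; apply/asboolP.
by exists z => // y Ay; apply: zA; apply/asboolP.
Qed.

Let r_total x y : r x y \/ r y x.
Proof.
have [z [->|->] zxy] := @has_min [set x; y] (ex_intro _ x (or_introl erefl)).
  by left; apply: zxy; right.
by right; apply: zxy; left.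
Qed.

Let r_anti x y : r x y -> r y x -> x = y.
Proof.
move=> xy yx; have [|z [_ zu]] := @r_wo (fun t => `[< t = x \/ t = y >]).
  by exists x; apply/asboolP; left.
have r_refl t : r t t by case: (r_total t t).
have zx : z = x.
  apply: zu; split; first by apply/asboolP; left.
  by move=> t /asboolP[] ->.
have zy : z = y.
  apply: zu; split; first by apply/asboolP; right.
  by move=> t /asboolP[] ->.
by rewrite -zx.
Qed.

Let below_wf : well_founded (fun y x => below x y).
Proof.
apply: contrapT => nwf.
have [|z nz zmin] := @has_min [set x | ~ Acc (fun y x => below x y) x].
  by have /existsNP := nwf.
apply: nz; constructor => y [yz ynz]; apply: contrapT => ny.
by apply: ynz; apply: r_anti => //; exact: zmin.
Qed.

(** This initial segment is the first uncountable ordinal: an initial segment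
    missing one of its elements lies below that element, hence is countable. *)
Definition countable_rank : set T := [set x | countable (below x)].

(** Otherwise the least element outside would have countably many
    predecessors, and would belong to the segment. *)
Lemma countable_rank_uncountable :
  ~ countable [set: T] -> ~ countable countable_rank.
Proof.
move=> uT cC.
have [|z nz zmin] := @has_min (~` countable_rank).
  apply: contrapT => nC; apply: uT; apply: (sub_countable _ cC).
  by apply: subset_card_le => x _; apply: contrapT => nCx; apply: nC; exists x.
apply: nz; apply: (sub_countable _ cC); apply: subset_card_le => y [yz ynz].
by apply: contrapT => ny; apply: ynz; apply: r_anti => //; exact: zmin.
Qed.

(** Transfinite recursion: each element of countable rank is sent to a point
    outside the countable set of values taken on its predecessors. *)
Lemma countable_rank_embeds (U : Type) :
  ~ countable [set: U] -> countable_rank #<= [set: U].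
Proof.
move=> uU.
have [u0] : inhabited U.
  apply: contrapT => nU; apply: uU; rewrite (_ : [set: U] = set0) //.
  by apply/seteqP; split => // u; case: nU; constructor.
pose pick (A : set U) := if pselect (A !=set0) is left e then sval (cid e) else u0.
have pickP A u : A u -> A (pick A).
  move=> Au; rewrite /pick; case: pselect => [e|[]]; last by exists u.
  exact: (svalP (cid e)).
pose step x (h : forall y, below x y -> U) : U :=
  pick [set u | forall y (yx : below x y), h y yx <> u].
pose g := Fix below_wf (fun=> U) step.
have gE x : g x = pick [set u | forall y, below x y -> g y <> u].
  rewrite /g Fix_eq //= => {}x h1 h2 h12; rewrite /step; congr (pick _).
  by apply/seteqP; split => u hu y yx; have := hu y yx; rewrite h12.
have gfresh x y : countable_rank x -> below x y -> g y <> g x.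
  move=> cx; rewrite (gE x).
  have [|nex] := pselect (exists u, forall y, below x y -> g y <> u).
    by case=> u hu yx; exact: (pickP [set v | forall y, below x y -> g y <> v] u hu).
  exfalso; apply: uU.
  have cg : countable (g @` below x) := sub_countable (card_image_le _ _) cx.
  apply: (sub_countable _ cg).
  apply: subset_card_le => u _; apply: contrapT => nu; apply: nex; exists u.
  by move=> z zx gzu; apply: nu; exists z.
have gI : {in countable_rank &, injective g}.
  move=> x y; rewrite !inE => cx cy gxy; apply: contrapT => xy.
  have [rxy|ryx] := r_total x y.
    by apply: (gfresh y x cy) => //; split.
  by apply: (gfresh x y cx) => //; split => // yx; exact: xy.
apply: card_le_trans (card_leT (g @` countable_rank)).
by have := inj_card_eq gI; rewrite card_eq_le => /andP[].
Qed.
End first_uncountable.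

Lemma exists_omega1 : exists W : Type, is_omega1 W.
Proof.
have [r r_wo] := well_ordering_principle (set nat).
pose C := countable_rank r.
have uC : ~ countable C by apply: countable_rank_uncountable uncountable_set_nat.
exists (set_type C); split.
  by rewrite (eq_countable (card_setT C)).
move=> U uU; rewrite (card_le_eql (card_setT C)).
exact: countable_rank_embeds.
Qed.

(** * Bounding the solvability cardinal *)

Section sc_bounds.
Variable R : realType.
Implicit Types (F : set (R -> R)) (D : (R -> R) -> R -> R).

(** This is the hereditary Lindelof property in the form needed for solution
    sets: if an equation [Df = g] is solvable in [F], by [f0] say, then the
    functions of [F] that do not solve it are covered by those members of a fixed
    countable family that contain no solution of it. *)
Definition countably_separated F :=
  exists (T : countType) (N : T -> set (R -> R)),
    forall D f f0, difference_operator D -> F f -> F f0 -> D f <> D f0 ->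
    exists2 k, N k f & forall f', F f' -> N k f' -> D f' <> D f0.

Lemma countably_separated_sub F G :
  F `<=` G -> countably_separated G -> countably_separated F.
Proof.
move=> FG [T [N sepN]]; exists T, N => D f f0 dD Ff Ff0 Dff0.
have [k Nf Nk] := sepN D f f0 dD (FG _ Ff) (FG _ Ff0) Dff0.
by exists k => // f' Ff'; apply: Nk; exact: FG.
Qed.

(** For each member of the countable family that contains no solution of some
    equation of [S], pick one such equation.  A common solution of these
    countably many equations is in none of these members, so it solves every
    equation of [S]. *)
Lemma solvability_property_omega1 F W :
  is_omega1 W -> countably_separated F -> solvability_property F W.
Proof.
move=> [uW minW] [T [N sepN]] S dS solS.
have ctbl_sol S' : S' `<=` S -> countable S' -> solvable_in F S'.
  move=> S'S cS'; apply: solS => //; split; last first.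
    by move=> /sub_countable /(_ cS').
  apply: card_le_trans cS' _; apply/infiniteP.
  by move=> /finite_set_countable.
pose excl k (e : ((R -> R) -> R -> R) * (R -> R)) :=
  S e /\ forall f, F f -> N k f -> e.1 f <> e.2.
pose S' := \bigcup_k [set e | exists h : exists e, excl k e, e = sval (cid h)].
have [||f Ff solf] := ctbl_sol S'.
- by move=> e [k _ [h ->]]; case: (svalP (cid h)).
- apply: bigcup_countable => // k _.
  have [h|nh] := pselect (exists e, excl k e).
    apply: (sub_countable _ (countable1 (sval (cid h)))).
    apply: subset_card_le => e [h' ->] /=.
    by rewrite (Prop_irrelevance h' h).
  by rewrite (_ : [set _ | _] = set0) //; apply/seteqP; split => // e [].
exists f => // D g SDg; apply: contrapT => Dfg.
have [||f0 Ff0 /(_ D g erefl) Df0g] := ctbl_sol [set (D, g)].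
- by move=> _ ->.
- exact: countable1.
have [|k Nkf Nk] := sepN D f f0 (dS _ _ SDg) Ff Ff0; first by rewrite Df0g.
have h : exists e, excl k e.
  by exists (D, g); split => // f' Ff' Nf' /=; rewrite -Df0g; exact: Nk.
have [_ /(_ f Ff Nkf)] := svalP (cid h); apply; apply: solf.
by exists k => //; exists h; rewrite -surjective_pairing.
Qed.

(** When [K] is countable, the subsystems of cardinality less than [K] are
    finite. *)
Lemma solvability_property_uncountable F S (K : Type) :
  difference_system S ->
  (forall S', S' `<=` S -> finite_set S' -> solvable_in F S') ->
  ~ solvable_in F S -> solvability_property F K -> ~ countable [set: K].
Proof.
move=> dS fS nS solF cK; apply: nS; apply: solF => // S' S'S [_ nKS'].
apply: fS => //; apply/finite_setPn => /(card_le_trans cK); exact: nKS'.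
Qed.

Lemma is_sc_omega1 F S W :
  is_omega1 W -> countably_separated F -> difference_system S ->
  (forall S', S' `<=` S -> finite_set S' -> solvable_in F S') ->
  ~ solvable_in F S -> is_sc F W.
Proof.
move=> oW sepF dS fS nS; split; first exact: solvability_property_omega1.
move=> K /(solvability_property_uncountable dS fS nS).
by have [_] := oW; exact.
Qed.

End sc_bounds.

(** * Approximate continuity *)

Section approximate_continuity.
Variable R : realType.
Notation mu := (@lebesgue_measure R).

Lemma lebesgue_measure_shift (h : R) (A : set R) : measurable A ->
  measurable ((fun t => t + h) @^-1` A) /\ mu ((fun t => t + h) @^-1` A) = mu A.
Proof.
pose s : R -> measurableTypeR R := fun t => t + h.
have ms : measurable_fun setT s by exact: measurable_funD.
move=> mA; split; first by rewrite -[X in measurable X]setTI; exact: ms.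
apply/esym; rewrite -[RHS]/(pushforward mu s A).
apply: lebesgue_measure_unique => //= _ [[a b]] _ <-.
rewrite /pushforward (_ : s @^-1` _ = `]a - h, b - h]%classic).
  rewrite !lebesgue_measure_itv/= !lte_fin ltrD2r.
  by case: ifP => // _; rewrite -!EFinB; congr EFin; ring.
by apply/seteqP; split => t; rewrite /s /= !in_itv/= => /andP[? ?]; apply/andP; split; lra.
Qed.

(** The translates of the sets [B i] are together too small to cover an
    interval of length [2 * r]. *)
Lemma avoid_small_sets n (B : 'I_n -> set R) (h : 'I_n -> R) (x r e : R) :
  (forall i, measurable (B i)) -> (forall i, (mu (B i) <= e%:E)%E) ->
  n%:R * e < 2 * r ->
  exists2 t, `|t - x| < r & forall i, ~ B i (t + h i).
Proof.
move=> mB eB ner; apply: contrapT => noT.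
pose U := \big[setU/set0]_(i < n) ((fun t => t + h i) @^-1` B i).
have [mU muU] : measurable U /\ (mu U <= \sum_(i < n) e%:E)%E.
  rewrite /U; elim/big_ind2 : _ => [|V v W w [mV Vv] [mW Ww]|i _].
  - by rewrite measure0; split.
  - split; first exact: measurableU.
    by apply: le_trans (leeD Vv Ww); exact: measureU2.
  - by have [m1 ->] := lebesgue_measure_shift (h i) (mB i); split.
have IU : `]x - r, x + r[ `<=` U.
  move=> t; rewrite /= in_itv/= => /andP[t1 t2]; apply: contrapT => nUt.
  apply: noT; exists t; first by rewrite ltr_norml; apply/andP; split; lra.
  by move=> i Bi; apply: nUt; rewrite /U (bigD1 i) //=; left.
have muI : (mu `](x - r)%R, (x + r)%R[ <= mu U)%E by apply: le_measure => //; rewrite inE.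
have := le_trans muI muU; have := le_trans (measure_ge0 mu U) muU.
rewrite lebesgue_measure_itv/= lte_fin sumEFin sumr_const card_ord -mulr_natl.
rewrite lee_fin => ne0; case: ifP => [_|/negbT].
  by rewrite -EFinB lee_fin; lra.
by rewrite -leNgt => ? _; lra.
Qed.

(** The complement of a measurable set of density one takes up an arbitrarily
    small proportion of small balls.  Enclosing it in a Borel set of the same
    measure makes translation invariance available. *)
Lemma density_one_small_complement (E : set R) (x eta : R) :
  lebesgue_measurable E -> density_one_at E x -> 0 < eta ->
  \forall r \near 0^'+, exists B : set R,
    [/\ measurable B, (mu B <= (eta * r)%:E)%E & ball x r `\` E `<=` B].
Proof.
rewrite /lebesgue_measurable g_sigma_completed_algebra_genE.
move=> [A mA [N [Z [mZ Z0 NZ]] <-]] dE eta0.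
have : nbhs 1%:E [set y : \bar R | ((1 - eta / 2)%:E < y)%E].
  by apply: open_nbhs_nbhs; split; [exact: open_ereal_gt_ereal|rewrite /= lte_fin; lra].
move=> /dE /= dense; near=> r.
have r0 : 0 < r by near: r; exact: nbhs_right_gt.
have mB : measurable (ball x r : set R) by exact: measurable_ball.
exists (ball x r `\` A); split; first exact: measurableD.
- have dr : ((1 - eta / 2)%:E < @completed_lebesgue_measure R
      ((A `|` N) `&` ball x r) / @completed_lebesgue_measure R (ball x r))%E.
    by near: r; exact: dense.
  have muIE : mu (ball x r) = (r *+ 2)%:E by rewrite lebesgue_measure_ball// ltW.
  have mIA : measurable (ball x r `&` A : set R) by exact: measurableI.
  have EA : (@completed_lebesgue_measure R ((A `|` N) `&` ball x r)
      <= mu (ball x r `&` A))%E.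
    rewrite -(measureU0 (mu := mu) mIA mZ Z0).
    apply: (@le_outer_measure R _ (mu_ext (@wlength R idfun))) => t [[At|/NZ Zt] xt].
    - by left.
    - by right.
  have muIA : mu (ball x r) = (mu (ball x r `\` A) + mu (ball x r `&` A))%E.
    exact: measureDI.
  have fIA : mu (ball x r `&` A) \is a fin_num.
    rewrite ge0_fin_numE// (@le_lt_trans _ _ (mu (ball x r)))//.
      by rewrite le_measure// inE.
    by rewrite muIE ltry.
  have fID : mu (ball x r `\` A) \is a fin_num.
    rewrite ge0_fin_numE// (@le_lt_trans _ _ (mu (ball x r)))//.
      by rewrite le_measure// inE//; exact: measurableD.
    by rewrite muIE ltry.
  move: dr muIA EA; rewrite -[@completed_lebesgue_measure R (ball x r)]/(mu (ball x r)).
  rewrite muIE -(fineK fIA) -(fineK fID); set a := fine _; set b := fine _.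
  set c := (X in (X / _)%E) => dr [] ab ca.
  have r2 : r *+ 2 != 0 by rewrite mulrn_eq0/= gt_eqF.
  have := lt_le_trans dr (lee_wpmul2r _ ca).
  rewrite inver (negbTE r2) lee_fin invr_ge0 -EFinM lte_fin => /(_ _).
  rewrite ltr_pdivlMr ?pmulrn_lgt0// => /(_ (mulrn_wge0 _ (ltW r0))).
  by rewrite lee_fin; lra.
- move=> t [xrt nE]; split => // At; apply: nE; left.
Unshelve. all: by end_near. Qed.

(** The exceptional set is enclosed in a Borel set, and its size is an absolute
    measure instead of a proportion of the ball, so that several exceptional
    sets can be translated and united. *)
Definition mostly_near (f : R -> R) (p r c d e : R) :=
  exists B : set R, [/\ measurable B, (mu B <= e%:E)%E &
    forall t, `|t - p| < r -> ~ B t -> `|f t - c| < d].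

Lemma approximately_continuous_mostly_near (f : R -> R) (x d eta : R) :
  approximately_continuous_functions f -> 0 < d -> 0 < eta ->
  \forall r \near 0^'+, mostly_near f x r (f x) d (eta * r).
Proof.
move=> /(_ x)[E [mE Ex dE fE]] d0 eta0.
have /fE : nbhs (f x) (ball (f x) d) by exact: nbhsx_ballx.
move=> [e /= e0 xeE].
near=> r.
have [B [mB muB EB]] : exists B : set R,
    [/\ measurable B, (mu B <= (eta * r)%:E)%E & ball x r `\` E `<=` B].
  by near: r; exact: density_one_small_complement.
have re : r < e by near: r; exact: nbhs_right_lt.
exists B; split=> // t tx nBt; rewrite distrC.
have xr : ball x r t by rewrite /ball/= distrC.
apply: xeE; last by apply: contrapT => nEt; apply: nBt; exact: EB.
exact: le_ball (ltW re) _ xr.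
Unshelve. all: by end_near. Qed.

End approximate_continuity.

(** * Separation by countably many sets *)

Section separation.
Variable R : realType.

Lemma mostly_near_weaken (f : R -> R) (p r c d e p' r' c' d' e' : R) :
  `|p' - p| + r' <= r -> `|c - c'| + d <= d' -> e <= e' ->
  mostly_near f p r c d e -> mostly_near f p' r' c' d' e'.
Proof.
move=> pr cd ee' [B [mB Be fB]]; exists B; split=> //.
  by apply: le_trans Be _; rewrite lee_fin.
move=> t tp' nBt.
have /(fB _)/(_ nBt) fc : `|t - p| < r.
  by have := ler_distD p' t p; lra.
by have := ler_distD c (f t) c'; lra.
Qed.

(** The sets of the countable family record, for finitely many rational balls,
    a rational approximation to the values of the function on most of the
    ball.  If [Df] and [Df0] differ at [x], enough such information on [f]
    around the translates of [x] fixes [Df] up to a small error on most points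
    near [x].  As [f0] is approximately continuous as well, [Df0] keeps away
    from these values on most points near [x], and so [Df'] cannot be equal to
    [Df0] for any [f'] sharing the information. *)
Theorem approximately_continuous_countably_separated :
  countably_separated (@approximately_continuous_functions R).
Proof.
exists (seq (rat * rat) * (rat * rat * rat))%type.
exists (fun k => [set f | forall pc, pc \in k.1 ->
  mostly_near f (ratr pc.1) (ratr k.2.1.1) (ratr pc.2) (ratr k.2.1.2)
    (ratr k.2.2)]).
move=> _ f f0 [n [a [b ->]]] acf acf0 Dff0.
have [x Dx] : exists x, \sum_(i < n) a i * f (x + b i) <>
                        \sum_(i < n) a i * f0 (x + b i).
  by apply/existsNP => Dx; apply: Dff0; apply/funext.
pose eps := `|\sum_(i < n) a i * f (x + b i) - \sum_(i < n) a i * f0 (x + b i)|.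
have eps0 : 0 < eps by rewrite normr_gt0 subr_eq0; exact/eqP.
(* [Df'(t)] will be within [2 * d * M] of [Df(x)], and [Df0(t)] within [d * M]
   of [Df0(x)]. *)
pose M := \sum_(i < n) `|a i|.
have M0 : 0 <= M by apply: sumr_ge0.
have [d /[!in_itv]/= /andP[d0 deps]] : exists d, ratr d \in `]0, eps / (3 * M + 1)[.
  by apply: rat_in_itvoo; rewrite divr_gt0//; lra.
(* Below, each of the [n] translates has an exceptional set of measure less
   than [4 * eta * r], which leaves some room in an interval of length [r]. *)
pose eta : R := (4 * n.+1%:R)^-1.
have eta0 : 0 < eta by rewrite invr_gt0 mulr_gt0.
have : \forall r \near 0^'+, forall i : 'I_n,
    mostly_near f (x + b i) r (f (x + b i)) (ratr d / 2) (eta * r) /\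
    mostly_near f0 (x + b i) r (f0 (x + b i)) (ratr d) (eta * r).
  apply: filter_forall => i; apply: filterI.
  - by apply: approximately_continuous_mostly_near => //; rewrite divr_gt0.
  - exact: approximately_continuous_mostly_near.
move=> [r0 /= r00 near0].
have [r /[!in_itv]/= /andP[rr0 rr1]] : exists r, ratr r \in `]0, r0 / 2[.
  by apply: rat_in_itvoo; rewrite divr_gt0.
have [nearf nearf0] : (forall i : 'I_n,
    mostly_near f (x + b i) (2 * ratr r) (f (x + b i)) (ratr d / 2)
      (eta * (2 * ratr r))) /\ (forall i : 'I_n,
    mostly_near f0 (x + b i) (ratr r) (f0 (x + b i)) (ratr d) (eta * ratr r)).
  split=> i.
    have [] := near0 (2 * ratr r) _ _ i => //; last lra.
    by rewrite /ball/= sub0r normrN gtr0_norm; lra.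
  have [] := near0 (ratr r) _ _ i => //.
  by rewrite /ball/= sub0r normrN gtr0_norm; lra.
have [e /[!in_itv]/= /andP[e1 e2]] :
    exists e, ratr e \in `]eta * (2 * ratr r), eta * (3 * ratr r)[.
  by apply: rat_in_itvoo; rewrite ltr_pM2l//; lra.
(* The data on [f] at radius [2 * r] survive the replacement of the centres
   and of the values of [f] by rational approximations. *)
have approx (y h : R) : 0 < h -> exists q : rat, `|y - ratr q| < h.
  move=> h0; have [|q /[!in_itv]/= qy] := @rat_in_itvoo R (y - h) (y + h).
    by lra.
  by exists q; rewrite distrC ltr_distl.
have /choice[p px] : forall i : 'I_n, exists q : rat, `|x + b i - ratr q| < ratr r / 2.
  by move=> i; apply: approx; lra.
have /choice[c cf] : forall i : 'I_n, exists q : rat,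
    `|f (x + b i) - ratr q| < ratr d / 2.
  by move=> i; apply: approx; lra.
exists ([seq (p i, c i) | i <- enum 'I_n], (r, d, e)).
  move=> _ /mapP[i _ ->] /=; apply: mostly_near_weaken (nearf i).
  - by rewrite distrC; have := px i; lra.
  - by have := cf i; lra.
  - exact: ltW.
move=> f' acf' nearf' Df'.
have /choice[B HB] : forall i : 'I_n, exists B : set R,
    [/\ measurable B, (lebesgue_measure B <= (ratr e + eta * ratr r)%:E)%E &
    forall t, `|t - (x + b i)| < ratr r / 2 -> ~ B t ->
      `|f' t - ratr (c i)| < ratr d /\ `|f0 t - f0 (x + b i)| < ratr d].
  move=> i; have [|B1 [mB1 Be1 fB1]] := nearf' (p i, c i).
    by rewrite map_f// mem_enum.
  have [B2 [mB2 Be2 fB2]] := nearf0 i.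
  exists (B1 `|` B2); split; first exact: measurableU.
    rewrite EFinD; apply: le_trans (leeD Be1 Be2); exact: measureU2.
  move=> t tx nBt; split; [apply: fB1|apply: fB2].
  - by have := ler_distD (x + b i) t (ratr (p i)); have := px i; rewrite /=; lra.
  - by move=> B1t; apply: nBt; left.
  - by lra.
  - by move=> B2t; apply: nBt; right.
have [|||t tx nBt] := @avoid_small_sets R n B b x (ratr r / 2) (ratr e + eta * ratr r).
- by move=> i; have [] := HB i.
- by move=> i; have [] := HB i.
- have etaE : eta * (4 * (n%:R + 1)) = 1 by rewrite natr1 mulVf.
  apply: (@le_lt_trans _ _ (n%:R * (4 * eta * ratr r))).
    by apply: ler_wpM2l => //; lra.
  rewrite (_ : n%:R * _ = (eta * (4 * (n%:R + 1)) - 4 * eta) * ratr r); last ring.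
  by rewrite etaE; nra.
have tb i : `|f' (t + b i) - ratr (c i)| < ratr d /\
            `|f0 (t + b i) - f0 (x + b i)| < ratr d.
  have [_ _] := HB i; apply; last exact: nBt.
  by rewrite opprD addrACA subrr addr0.
have : eps <= \sum_(i < n) `|a i| * (3 * ratr d).
  have /(congr1 (fun g => g t)) /= Df't := Df'.
  have -> : eps = `|\sum_(i < n) (a i * f (x + b i) - a i * f0 (x + b i)
      - (a i * f' (t + b i) - a i * f0 (t + b i)))|.
    by rewrite !sumrB Df't subrr subr0.
  rewrite (le_trans (ler_norm_sum _ _ _))// ler_sum// => i _.
  rewrite -!mulrBr normrM ler_wpM2l//.
  have [f't f0t] := tb i; have := cf i.
  by move: f't f0t; rewrite !ltr_norml ler_norml; lra.
rewrite -mulr_suml -/M leNgt => /negP; apply.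
by move: deps; rewrite ltr_pdivlMr; nra.
Qed.

End separation.

Section derivative_separation.
Variable R : realType.

Lemma continuous_approximately_continuous (f : R -> R) :
  continuous f -> approximately_continuous_functions f.
Proof.
move=> cf x; exists setT; split => //.
- exact: (@measurableT _ (g_sigma_algebraType (completed_algebra_gen (@lebesgue_measure R)))).
- rewrite /density_one_at; apply: cvg_near_cst; near=> r.
  have r0 : 0 < r by near: r; exact: nbhs_right_gt.
  rewrite setTI -[@completed_lebesgue_measure R _]/(@lebesgue_measure R (ball x r)).
  rewrite lebesgue_measure_ball ?ltW// divee// eqe mulrn_eq0/=.
  by rewrite gt_eqF.
- by apply: cvg_trans (cf x); apply: cvg_app; exact: cvg_within.
Unshelve. all: by end_near. Qed.

Lemma is_derive_sum_affine n (c w u : 'I_n -> R) (G g : R -> R) (x : R) :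
  (forall y : R, is_derive y 1 G (g y)) ->
  is_derive x 1 (fun x => \sum_(i < n) c i * G (w i * x + u i))
    (\sum_(i < n) c i * w i * g (w i * x + u i)).
Proof.
move=> dG.
have daff i : is_derive x 1 (fun x => w i * x + u i) (w i).
  have -> : (fun x => w i * x + u i) = (w i \*: (@id R)) + cst (u i) by [].
  by apply: is_derive_eq; rewrite addr0; exact: mulr1.
have dterm i : is_derive x 1 (fun x => c i * G (w i * x + u i))
    (c i * w i * g (w i * x + u i)).
  have := is_deriveZ (c i) (@is_derive1_comp R G (fun x => w i * x + u i) x _ _ (dG _) (daff i)).
  move/is_derive_eq; apply. by rewrite (mulrC (g _)) -mulrA.
have := is_derive_sum dterm.
by congr (is_derive _ _ _ _); apply/funext => y; rewrite fct_sumE.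
Qed.

Lemma is_derive_continuous (G g : R -> R) :
  (forall x : R, is_derive x 1 G (g x)) -> continuous G.
Proof.
by move=> dG x; apply/differentiable_continuous/derivable1_diffP; case: (dG x).
Qed.

Lemma difference_operator_increment (D : (R -> R) -> R -> R) (x : R) :
  difference_operator D ->
  difference_operator (fun f t => D f (t + x) - D f t).
Proof.
move=> [n [a [b ->]]]; exists (n + n)%N.
exists (fun i => match fintype.split i with inl j => a j | inr j => - a j end).
exists (fun i => match fintype.split i with inl j => x + b j | inr j => b j end).
apply/funext => f; apply/funext => t; rewrite big_split_ord/= -sumrN.
congr (_ + _); apply: eq_bigr => i _.
  by case: split_ordP => j /eqP; rewrite ?eq_shift// => /eqP ->; rewrite addrA.
by case: split_ordP => j /eqP; rewrite ?eq_shift// => /eqP ->; rewrite mulNr.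
Qed.

(** For derivatives, [Df = Df0] says that [DG - DG0] is constant, where [G] and
    [G0] are antiderivatives of [f] and [f0].  So the continuous functions [G]
    can be separated in place of [f], using the difference operators
    [G |-> DG (t + x) - DG t]. *)
Theorem derivatives_countably_separated :
  countably_separated (@derivatives R).
Proof.
have [T [N sepN]] := approximately_continuous_countably_separated R.
exists T, (fun k => [set f | exists2 G : R -> R,
  N k G & forall x : R, is_derive x 1 G (f x)]).
move=> D f f0 dD [G dG] [G0 dG0] Dff0.
have ac (H h : R -> R) : (forall x : R, is_derive x 1 H (h x)) ->
    approximately_continuous_functions H.
  by move=> /is_derive_continuous; exact: continuous_approximately_continuous.
have dDG (H h : R -> R) (x : R) : (forall x : R, is_derive x 1 H (h x)) ->
    is_derive x 1 (D H) (D h x).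
  case: dD => n [a [b ->]] dH.
  rewrite [X in is_derive _ _ X](_ : _ = fun x => \sum_(i < n) a i * H (1 * x + b i)).
    apply: is_derive_eq (is_derive_sum_affine a (fun=> 1) b x dH) _.
    by apply: eq_bigr => i _; rewrite mulr1 mul1r.
  by apply/funext => y; apply: eq_bigr => i _; rewrite mul1r.
have [x Dx] : exists x, D G (0 + x) - D G 0 <> D G0 (0 + x) - D G0 0.
  apply/existsNP => DG; apply: Dff0; apply/funext => x.
  have := is_deriveB (dDG _ _ x dG) (dDG _ _ x dG0).
  have -> : D G - D G0 = cst (D G 0 - D G0 0).
    apply/funext => t; move: (DG t); rewrite add0r => ?.
    by change (D G t - D G0 t = D G 0 - D G0 0); lra.
  move=> dcst; apply/eqP; rewrite -subr_eq0; apply/eqP.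
  by rewrite -(@derive_val _ _ _ _ _ _ _ dcst) derive_cst.
have [|k NG Nk] := sepN _ G G0 (difference_operator_increment x dD) (ac _ _ dG) (ac _ _ dG0).
  by move=> /(congr1 (fun h => h 0)).
exists k; first by exists G.
move=> f' _ [G' NG' dG'] Df'.
apply: (Nk G' (ac _ _ dG') NG'); apply/funext => t.
have /(_ (t + x) t) : forall y z, (D G' - D G0) y = (D G' - D G0) z.
  move=> y z; apply: is_derive_0_is_cst => s.
  by have := is_deriveB (dDG _ _ s dG') (dDG _ _ s dG0); rewrite Df' subrr.
move=> DG't; have {}DG't : D G' (t + x) - D G0 (t + x) = D G' t - D G0 t by [].
by lra.
Qed.

End derivative_separation.

(** * Sums of cosines lie in all the function classes *)

Section cos_sums.
Variable R : realType.

Definition cos_sum n (c w u : 'I_n -> R) (x : R) : R :=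
  \sum_(i < n) c i * cos (w i * x + u i).

Lemma is_derive_cos_sum n (c w u : 'I_n -> R) (x : R) :
  is_derive x 1 (cos_sum c w u)
    (cos_sum (fun i => c i * w i) w (fun i => u i + pi / 2) x).
Proof.
apply: is_derive_eq (is_derive_sum_affine c w u x (@is_derive_cos R)) _.
by apply: eq_bigr => i _; rewrite addrA cosDpihalf.
Qed.

Lemma cos_sum_bounded_by n (c w u : 'I_n -> R) (x : R) :
  `|cos_sum c w u x| <= \sum_(i < n) `|c i|.
Proof.
apply: le_trans (ler_norm_sum _ _ _) _; apply: ler_sum => i _.
by rewrite normrM ler_piMr// cos_max.
Qed.

Lemma cos_sum_bounded n (c w u : 'I_n -> R) : bounded_functions (cos_sum c w u).
Proof.
exists (\sum_(i < n) `|c i|); split; first exact: num_real.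
move=> M cM x _ /=; apply: le_trans (ltW cM); exact: cos_sum_bounded_by.
Qed.

Lemma cos_sum_continuous n (c w u : 'I_n -> R) : continuous (cos_sum c w u).
Proof. exact: is_derive_continuous (is_derive_cos_sum c w u). Qed.

Lemma cos_sum_lipschitz n (c w u : 'I_n -> R) :
  lipschitz_functions (cos_sum c w u).
Proof.
exists (\sum_(i < n) `|c i * w i|); split; first exact: num_real.
move=> M cM [x y] _ /=.
have lip (a b : R) : a < b ->
    `|cos_sum c w u b - cos_sum c w u a| <= M * `|b - a|.
  move=> ab.
  have [|t _ ->] := MVT ab (fun x _ => is_derive_cos_sum c w u x).
    by apply: continuous_subspaceT; exact: cos_sum_continuous.
  rewrite normrM ler_wpM2r//; apply: le_trans (ltW cM).
  exact: cos_sum_bounded_by.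
have [xy|yx|->] := ltgtP x y; last by rewrite !subrr normr0 mulr0.
  by rewrite distrC (distrC x); exact: lip.
exact: lip.
Qed.

(** Shifting the phases by [pi / 2] keeps the derivatives in the same form. *)
Lemma derive1n_cos_sum n (c w u : 'I_n -> R) k :
  exists c' u' : 'I_n -> R, derive1n k (cos_sum c w u) = cos_sum c' w u'.
Proof.
elim: k => [|k [c' [u' IH]]]; first by exists c, u.
exists (fun i => c' i * w i), (fun i => u' i + pi / 2).
rewrite derive1nS IH; apply/funext => x; rewrite derive1E.
by have := is_derive_cos_sum c' w u' x => ?; rewrite derive_val.
Qed.

Lemma cos_sum_C_infty n (c w u : 'I_n -> R) : C_infty (cos_sum c w u).
Proof.
move=> m; split=> [k x _|].
  have [c' [u' ->]] := derive1n_cos_sum c w u k.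
  by have := is_derive_cos_sum c' w u' x; case.
by have [c' [u' ->]] := derive1n_cos_sum c w u m; exact: cos_sum_continuous.
Qed.

Lemma cos_sum_derivative n (c w u : 'I_n -> R) :
  (forall i, w i != 0) -> derivatives (cos_sum c w u).
Proof.
move=> w0; exists (fun x => \sum_(i < n) (c i / w i) * sin (w i * x + u i)) => x.
have := is_derive_sum_affine (fun i => c i / w i) w u x (@is_derive_sin R).
by move/is_derive_eq; apply; apply: eq_bigr => i _; rewrite divfK.
Qed.

Lemma cos_sum_analytic n (c w u : 'I_n -> R) :
  real_analytic_functions (cos_sum c w u).
Proof.
move=> x0; suff [a aE] : exists a : nat -> R, forall x,
    pseries a (x - x0) @ \oo --> cos_sum c w u x by exists a, 1.
elim: n c w u => [|n IH] c w u.
  exists (fun=> 0) => x; rewrite /cos_sum big_ord0 (_ : pseries _ _ = cst 0).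
    exact: cvg_cst.
  by apply/funext => m; rewrite /pseries /series/= big1// => i _; rewrite mul0r.
pose wd i := widen_ord (leqnSn n) i.
have [a aE] := IH (c \o wd) (w \o wd) (u \o wd).
pose cn := c ord_max; pose wn := w ord_max; pose un := u ord_max.
(* The cosine of [v + wn * (x - x0)] is expanded by the addition formula, and
   then by the power series of sine and cosine. *)
pose v := wn * x0 + un.
exists (fun j => a j + cn * (cos v * cos_coeff wn j - sin v * sin_coeff wn j)).
move=> x.
have -> : cos_sum c w u x = cos_sum (c \o wd) (w \o wd) (u \o wd) x +
    cn * (cos v * cos (wn * (x - x0)) - sin v * sin (wn * (x - x0))).
  by rewrite /cos_sum big_ord_recr/= -cosD; congr (_ + _ * cos _); rewrite /v /wn /un; ring.
rewrite (_ : pseries _ _ = pseries a (x - x0) \+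
  (cst cn \* (cst (cos v) \* series (cos_coeff (wn * (x - x0))) \-
              cst (sin v) \* series (sin_coeff (wn * (x - x0)))))).
  apply: cvgD; first exact: aE.
  apply: cvgM; first exact: cvg_cst.
  apply: cvgB; (apply: cvgM; first exact: cvg_cst).
    by rewrite unlock; exact: is_cvg_series_cos_coeff.
  by rewrite unlock; exact: is_cvg_series_sin_coeff.
apply/funext => m; rewrite /pseries /series/= !mulr_sumr -sumrB mulr_sumr.
rewrite -big_split/=; apply: eq_bigr => j _.
by rewrite /cos_coeff /sin_coeff /= exprMn; ring.
Qed.

End cos_sums.

(** * An unsolvable system with solvable finite subsystems *)

Section lacunary_system.
Variable R : realType.

Definition lacunary (A q u : R) (n : nat) : R -> R :=
  cos_sum (fun k : 'I_n => A * q ^+ k) (fun k => 2 * pi * 2 ^+ k) (fun=> u).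

Lemma lacunaryS (A q u : R) n x : lacunary A q u n.+1 x =
  lacunary A q u n x + A * q ^+ n * cos (2 * pi * 2 ^+ n * x + u).
Proof. by rewrite /lacunary /cos_sum big_ord_recr. Qed.

(** The amplitudes grow so fast that each one exceeds [15] times the sum of the
    preceding ones. *)
Lemma lacunary_head_small (A q u : R) n x : 0 < A -> 16 <= q ->
  15 * `|lacunary A q u n x| <= A * q ^+ n.
Proof.
move=> A0 q16.
suff : 15 * \sum_(k < n) `|A * q ^+ k| <= A * q ^+ n.
  by apply: le_trans; rewrite ler_wpM2l//; exact: cos_sum_bounded_by.
elim: n => [|n IH]; first by rewrite big_ord0 mulr0 expr0 mulr1 ltW.
have Aq0 : 0 < A * q ^+ n by rewrite mulr_gt0// exprn_gt0//; lra.
rewrite big_ord_recr/= exprS gtr0_norm// mulrDr mulrCA; nra.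
Qed.

(** The frequencies [2 ^ k] with [n <= k] are invisible to the translation by
    [2 ^ (- n)]. *)
Lemma lacunary_increment (A q u : R) n m x : (n <= m)%N ->
  lacunary A q u m (x + 2 ^- n) - lacunary A q u m x =
  lacunary A q u n (x + 2 ^- n) - lacunary A q u n x.
Proof.
move=> /subnKC <-; elim: (m - n)%N => [|j IH]; first by rewrite addn0.
rewrite addnS !lacunaryS -IH.
suff -> : cos (2 * pi * 2 ^+ (n + j) * (x + 2 ^- n) + u) =
          cos (2 * pi * 2 ^+ (n + j) * x + u) by ring.
rewrite (_ : _ + u = 2 * pi * 2 ^+ (n + j) * x + u + (pi *+ 2) *+ (2 ^ j)%N).
  exact: (periodicn (@cosD2pi R)).
rewrite -(mulr_natr _ (2 ^ j)%N) natrX -(mulr_natr pi 2) exprD.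
by field; rewrite expf_neq0.
Qed.

(** On the scale [2 ^ (- n)] the increments of [lacunary A q u n] are dominated
    by their top frequency, which the translation reverses.  Three increments at
    consecutive quarter periods detect both a cosine and a sine of the same
    phase, so that their differences cannot all be small; an approximately
    continuous function has close values at the five points involved.  Using
    differences of increments makes the constants [C n] harmless. *)
Lemma lacunary_increments_unsolvable (A q u : R) (C : nat -> R) (phi : R -> R) :
  0 < A -> 16 <= q -> approximately_continuous_functions phi ->
  ~ (forall n x, phi (x + 2 ^- n) - phi x =
       C n + (lacunary A q u n (x + 2 ^- n) - lacunary A q u n x)).
Proof.
move=> A0 q16 acphi phiE.
have [||r0 /= r00 near0] :=
    @approximately_continuous_mostly_near R phi 0 1 8^-1 acphi => //.
(* The top amplitude [A * q ^ m] must exceed [4], and the five points, spaced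
   by [d = 2 ^ (- (m + 2))], must stay in the ball of radius [r0 / 2]. *)
have [m mA mr] : exists2 m, 4 < A * 2 ^+ m & 4 < r0 * 2 ^+ m :> R.
  have A4 : 0 < 4 / A by rewrite divr_gt0.
  have r4 : 0 < 4 / r0 by rewrite divr_gt0.
  have [m bm] : exists m, 4 / A + 4 / r0 < m%:R.
    by exists (Num.bound (4 / A + 4 / r0)); apply: archi_boundP; lra.
  have m2 : m%:R < 2 ^+ m :> R by rewrite -natrX ltr_nat ltn_expl.
  by exists m; rewrite -ltr_pdivrMl// mulrC; lra.
have {}mA : 4 < A * q ^+ m.
  apply: lt_le_trans mA _; apply: ler_wpM2l; first exact: ltW.
  by apply: lerXn2r; rewrite ?nnegrE//; lra.
set E := A * q ^+ m in mA.
pose d : R := 2 ^- m.+2.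
have d0 : 0 < d by rewrite invr_gt0 exprn_gt0.
have dm : 4 * d * 2 ^+ m = 1 by rewrite /d !exprS; field; rewrite expf_neq0.
have d2 : 2 ^- m.+1 = 2 * d.
  by rewrite /d [2 ^+ m.+2]exprS; field; rewrite expf_neq0.
have dr : 4 * d < r0 / 4.
  by rewrite -(ltr_pM2r (x := 2 ^+ m)) ?exprn_gt0// dm; lra.
have [||B [mB muB nearB]] := near0 (r0 / 2) => //.
- by rewrite /ball/= sub0r normrN gtr0_norm; lra.
- lra.
have [|||t t0 nB] := @avoid_small_sets R 5 (fun=> B) (fun j => j%:R * d) 0
  (r0 / 4) (8^-1 * (r0 / 2)) => //.
  lra.
have near j : (j < 5)%N -> `|phi (t + j%:R * d) - phi 0| < 1.
  move=> j5; apply: nearB; last exact: (nB (Ordinal j5)).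
  have j4 : j%:R <= 4 :> R by rewrite ler_nat.
  have jd : 0 <= j%:R * d by rewrite mulr_ge0// ltW.
  move: t0; rewrite !subr0 !ltr_norml => /andP[? ?].
  by apply/andP; split; nra.
pose L j := lacunary A q u m (t + j%:R * d).
have L_small j : 15 * `|L j| <= E by exact: lacunary_head_small.
pose a := 2 * pi * 2 ^+ m * t + u.
pose W j := cos (2 * pi * 2 ^+ m * (t + j%:R * d) + u).
have WE j : W j = cos (a + j%:R * (pi / 2)).
  rewrite /W /a; congr cos; rewrite mulrDr addrAC; congr (_ + _).
  have piE : pi = 4 * d * 2 ^+ m * pi :> R by rewrite dm mul1r.
  by rewrite [X in _ = _ * (X / 2)]piE; field.
have step j : phi (t + j.+2%:R * d) - phi (t + j%:R * d) =
    C m.+1 + (L j.+2 + E * W j.+2 - (L j + E * W j)).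
  have := phiE m.+1 (t + j%:R * d); rewrite !lacunaryS.
  rewrite (_ : t + j%:R * d + 2 ^- m.+1 = t + j.+2%:R * d)//.
  by rewrite d2 -addrA -mulrDl -natrD addn2.
have W0 : W 0 = cos a by rewrite WE mul0r addr0.
have W1 : W 1 = - sin a by rewrite WE mul1r cosDpihalf.
have W2 : W 2 = - cos a by rewrite WE mulrC divfK// cosDpi.
have W3 : W 3 = sin a.
  rewrite WE (_ : _ + _ = a + pi / 2 + pi); last by field.
  by rewrite cosDpi cosDpihalf opprK.
have W4 : W 4 = cos a.
  rewrite WE (_ : _ + _ = a + pi *+ 2) ?cosD2pi//; by field.
(* Subtracting [s0] and [s2] bounds [4 * E * cos a] by [4 + 4 * E / 15];
   combining all three bounds [4 * E * sin a] by [8 + 8 * E / 15]. *)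
have E0 : 0 < E by lra.
have := step 0; have := step 1; have := step 2; rewrite W0 W1 W2 W3 W4.
move: (near 0 isT) (near 1 isT) (near 2 isT) (near 3 isT) (near 4 isT).
move: (L_small 0) (L_small 1) (L_small 2) (L_small 3) (L_small 4).
rewrite -![15 * _ <= E]ler_pdivlMl// !ler_norml !ltr_norml.
move=> /andP[? ?] /andP[? ?] /andP[? ?] /andP[? ?] /andP[? ?].
move=> /andP[? ?] /andP[? ?] /andP[? ?] /andP[? ?] /andP[? ?] s2 s1 s0.
have := cos2Dsin2 a; move: s0 s1 s2; set c := cos a; set s := sin a => s0 s1 s2 cs.
have c1 : c < 1 / 3 by rewrite -(ltr_pM2l E0); lra.
have c2 : - (1 / 3) < c by rewrite -(ltr_pM2l E0); lra.
have s3 : s < 2 / 3 by rewrite -(ltr_pM2l E0); lra.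
have s4 : - (2 / 3) < s by rewrite -(ltr_pM2l E0); lra.
have : c ^+ 2 < 1 / 9 by nra.
have : s ^+ 2 < 4 / 9 by nra.
lra.
Qed.

End lacunary_system.

Section lower_bound.
Variable R : realType.

(** The frequencies and amplitudes are chosen so that the antiderivatives
    [sum_(k < n) 16 ^ k * sin (2 * pi * 2 ^ k * x)] of the approximants are
    lacunary sums as well. *)
Definition approximant (n : nat) : R -> R := lacunary (2 * pi) 32 0 n.

Definition translation_system : set (((R -> R) -> R -> R) * (R -> R)) :=
  range (fun n : nat => (fun f x => f (x + 2 ^- n) - f x,
    fun x => approximant n (x + 2 ^- n) - approximant n x)).

Lemma translation_system_difference : difference_system translation_system.
Proof.
move=> D g [n _ [<- _]]; exists 2.
exists (fun i => if i == ord0 then 1 else -1).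
exists (fun i => if i == ord0 then 2 ^- n else 0).
apply/funext => f; apply/funext => x.
by rewrite big_ord_recl big_ord1 /= mul1r mulN1r addr0.
Qed.

(** An approximant satisfies its own equation and all the preceding ones. *)
Lemma finite_translation_system_solvable S' :
  S' `<=` translation_system -> finite_set S' ->
  exists N, solution S' (approximant N).
Proof.
move=> S'S /finite_seqP[s S's].
have [N sN] : exists N, forall e, e \in s -> exists2 n, (n <= N)%N &
    e = (fun f x => f (x + 2 ^- n) - f x,
      fun x => approximant n (x + 2 ^- n) - approximant n x).
  have : {subset s <= translation_system}.
    by move=> e es; rewrite inE; apply: S'S; rewrite S's.
  elim: s {S's} => [|e s IH] sS; first by exists 0.
  have [|N sN] := IH; first by move=> e' e's; apply: sS; rewrite inE e's orbT.
  have := sS e (mem_head _ _); rewrite inE => -[n _ en].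
  exists (maxn n N) => e'; rewrite inE => /predU1P[->|/sN[n' n'N ->]].
    by exists n; rewrite ?leq_maxl.
  by exists n' => //; rewrite (leq_trans n'N)// leq_maxr.
exists N => D g SDg.
have [|n nN [-> ->]] := sN (D, g); first by move: SDg; rewrite S's.
by apply/funext => x; exact: lacunary_increment.
Qed.

Lemma translation_systemP f : solution translation_system f -> forall n x,
  f (x + 2 ^- n) - f x = approximant n (x + 2 ^- n) - approximant n x.
Proof.
move=> solf n x.
by have /(congr1 (fun h => h x)) := solf _ _ (ex_intro2 _ _ n I erefl).
Qed.

Lemma translation_system_approximately_continuous :
  ~ solvable_in (@approximately_continuous_functions R) translation_system.
Proof.
move=> [f acf /translation_systemP solf].
apply: (@lacunary_increments_unsolvable R (2 * pi) 32 0 (fun=> 0) f) => //.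
- by rewrite mulr_gt0// pi_gt0.
- by rewrite ler_nat.
- by move=> n x; rewrite add0r solf.
Qed.

(** An antiderivative of a solution is continuous, and it satisfies the
    equations of a lacunary system up to additive constants. *)
Lemma translation_system_derivatives :
  ~ solvable_in (@derivatives R) translation_system.
Proof.
move=> [f [G dG] /translation_systemP solf].
pose P n : R -> R := lacunary 1 16 (- (pi / 2)) n.
have dP n (x : R) : is_derive x 1 (P n) (approximant n x).
  apply: is_derive_eq; first exact: is_derive_cos_sum.
  apply: eq_bigr => k _; rewrite addNr.
  by rewrite (_ : 32 = 16 * 2) ?exprMn; ring.
have dincr (H h : R -> R) (s x : R) : (forall x : R, is_derive x 1 H (h x)) ->
    is_derive x 1 (fun x => H (x + s) - H x) (h (x + s) - h x).
  move=> dH.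
  have ds : is_derive x 1 (fun x => H (x + s)) (h (x + s)).
    have -> : (fun x => H (x + s)) = H \o shift s by [].
    have := @is_derive1_comp R H (shift s) x _ _ (dH _) (is_derive_shift x 1 s).
    by move/is_derive_eq; apply; rewrite mulr1.
  exact: is_deriveB ds (dH x).
apply: (@lacunary_increments_unsolvable R 1 16 (- (pi / 2))
  (fun n => G (0 + 2 ^- n) - G 0 - (P n (0 + 2 ^- n) - P n 0)) G) => //.
- by apply: continuous_approximately_continuous; exact: is_derive_continuous dG.
- move=> n x; apply/eqP; rewrite -subr_eq; apply/eqP.
  pose H := (fun x => G (x + 2 ^- n) - G x) - (fun x => P n (x + 2 ^- n) - P n x).
  rewrite -[LHS]/(H x) -[RHS]/(H 0); apply: is_derive_0_is_cst => y.
  have := is_deriveB (dincr _ _ (2 ^- n) y dG) (dincr _ _ (2 ^- n) y (dP n)).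
  by rewrite solf subrr.
Qed.

Lemma approximant_trig n : trig_polynomials (approximant n).
Proof.
exists (2 ^ n)%N, (fun j => \sum_(k < n) (j == 2 ^ k)%N%:R * (2 * pi * 32 ^+ k)), (fun=> 0).
apply/funext => x; rewrite big1 ?add0r; last first.
  by move=> k _; rewrite ltn_eqF ?expn_gt0// mul0r.
under [RHS]eq_bigr do rewrite mul0r addr0 mulr_suml.
rewrite exchange_big/=; apply: eq_bigr => k _.
rewrite (bigD1_seq (2 ^ k)%N) ?iota_uniq//=; last first.
  by rewrite mem_index_iota expn_gt0/= ltnS leq_exp2l// ltnW.
rewrite eqxx mul1r big1 ?addr0 ?natrX//.
by move=> j /negbTE ->; rewrite !mul0r.
Qed.

Lemma approximant_derivative n : derivatives (approximant n).
Proof.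
apply: cos_sum_derivative => i.
by rewrite !mulf_neq0// ?expf_neq0// gt_eqF// pi_gt0.
Qed.

End lower_bound.

(** * Solvability cardinals of the function classes *)

Section classes.
Variable R : realType.

Lemma trig_polynomial_continuous :
  @trig_polynomials R `<=` @continuous_functions R.
Proof.
move=> _ [m [a [b ->]]].
have ctrig w : continuous (fun x : R => cos (w * x)) /\
               continuous (fun x : R => sin (w * x)).
  have cw : continuous (fun x : R => w * x) by exact: mulrl_continuous.
  by split=> x; apply: continuous_comp (cw x) _; [exact: continuous_cos|exact: continuous_sin].
elim: m => [|m IH].
  by under eq_fun do rewrite big_geq// addr0; exact: cst_continuous.
under eq_fun do rewrite big_nat_recr//= addrA.
move=> x; apply: cvgD; first exact: IH.
have [cc cs] := ctrig (2 * pi * m.+1%:R).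
by apply: cvgD; apply: cvgM; [exact: cvg_cst|exact: cc|exact: cvg_cst|exact: cs].
Qed.

Lemma lipschitz_continuous : @lipschitz_functions R `<=` @continuous_functions R.
Proof.
move=> f [M [_ fM]] x; pose K := `|M| + 1.
have K0 : 0 < K by rewrite ltr_wpDl.
have fK (y z : R) : `|f y - f z| <= K * `|y - z|.
  by apply: (fM K _ (y, z)) => //; rewrite /K; have := ler_norm M; lra.
apply/cvgrPdist_lt => e e0; near=> y.
apply: le_lt_trans (fK _ _) _; rewrite -ltr_pdivlMl// mulrC.
by near: y; apply: cvgr_dist_lt; rewrite ?divr_gt0//; exact: cvg_id.
Unshelve. all: by end_near. Qed.

Lemma C_continuous n : @C_ R n `<=` @continuous_functions R.
Proof.
case: n => [|n] f [df cf]; first exact: cf.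
by move=> x; apply/differentiable_continuous/derivable1_diffP; exact: (df 0%N).
Qed.

(** A convergent power series is Lipschitz at its centre, because its
    coefficients grow at most geometrically. *)
Lemma real_analytic_continuous :
  @real_analytic_functions R `<=` @continuous_functions R.
Proof.
move=> f fan x; have [a [r [r0 fa]]] := fan x.
pose rho := r / 2; have rho0 : 0 < rho by rewrite divr_gt0.
have [M [M0 aM]] : exists M, 0 <= M /\ forall i, `|a i * rho ^+ i| <= M.
  have : cvgn (pseries a rho).
    apply/cvg_ex; exists (f (x + rho)); have := fa (x + rho).
    by rewrite [x + rho - x]addrC addKr gtr0_norm//; apply; rewrite /rho; lra.
  move=> /cvg_series_cvg_0/cvgP/cvg_seq_bounded[M [_ bM]].
  exists (`|M| + 1); split; first by have := normr_ge0 M; lra.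
  by move=> i; apply: bM => //; have := ler_norm M; lra.
have partial h N : `|h| <= rho / 2 ->
    `|pseries a h N.+1 - a 0%N| <= M * (`|h| / rho) * (2 - 2 / 2 ^+ N).
  move=> hr; set z := `|h| / rho.
  have zE : `|h / rho| = z by rewrite normrM normfV (gtr0_norm rho0).
  have z0 : 0 <= z by rewrite divr_ge0// ltW.
  have z2 : z <= 2^-1 by rewrite ler_pdivrMr// mulrC.
  elim: N => [|N IH].
    rewrite /pseries /series/= big_nat1 expr0 mulr1 subrr normr0.
    by rewrite invr1 mulr1 subrr mulr0.
  rewrite /pseries seriesSr -/(pseries a h) addrAC.
  apply: le_trans (ler_normD _ _) _.
  (* as [z <= 1 / 2], the term of index [N + 1] is at most [M * z / 2 ^ N] *)
  have aN : `|a N.+1 * h ^+ N.+1| <= M * z * 2 ^- N.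
    have -> : a N.+1 * h ^+ N.+1 = a N.+1 * rho ^+ N.+1 * (h / rho) ^+ N.+1.
      by rewrite -mulrA -exprMn mulrCA divff ?mulr1// gt_eqF.
    rewrite normrM normrX zE [z ^+ _]exprS mulrA -exprVn.
    apply: ler_pM; [exact: mulr_ge0|exact: exprn_ge0|exact: ler_wpM2r|].
    by apply: lerXn2r; rewrite ?nnegrE.
  have := lerD IH aN; move/le_trans; apply.
  rewrite -mulrDr [2 ^+ N.+1]exprS; apply: ler_wpM2l; first exact: mulr_ge0.
  by rewrite (_ : 2 / (2 * 2 ^+ N) = 2 ^- N); [lra|rewrite invfM mulVKf].
have near_a h : `|h| <= rho / 2 -> `|f (x + h) - a 0%N| <= M * (`|h| / rho) * 2.
  move=> hr; have hrr : `|x + h - x| < r.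
    by rewrite addrC addKr; move: hr; rewrite /rho; lra.
  have := fa _ hrr; rewrite [x + h - x]addrC addKr => fah.
  have {}fah : `|pseries a h N.+1 - a 0%N| @[N --> \oo] --> `|f (x + h) - a 0%N|.
    by apply: cvg_norm; apply: cvgB; [move: fah; rewrite -cvg_shiftS|exact: cvg_cst].
  apply: ler_cvg_to fah (cvg_cst (M * (`|h| / rho) * 2)) _; near=> N.
  apply: le_trans (partial h N hr) _; apply: ler_wpM2l.
    by rewrite mulr_ge0// divr_ge0// ltW.
  by rewrite lerBlDr lerDl divr_ge0// exprn_ge0.
have fx : f x = a 0%N.
  have := near_a 0; rewrite normr0 addr0 mul0r mulr0 mul0r normr_le0 subr_eq0.
  by move=> fx; apply/eqP/fx; rewrite divr_ge0// ltW.
pose K := M / rho * 2; have K0 : 0 <= K by rewrite mulr_ge0// divr_ge0// ltW.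
apply/cvgrPdist_lt => e e0; near=> y.
have yx : `|y - x| <= rho / 2.
  rewrite distrC; near: y; apply: (@cvgr_dist_le _ _ _ (nbhs x)); first exact: cvg_id.
  by rewrite divr_gt0.
have ye : `|y - x| < e / (K + 1).
  rewrite distrC; near: y; apply: (@cvgr_dist_lt _ _ _ (nbhs x)); first exact: cvg_id.
  by rewrite divr_gt0//; lra.
have := near_a _ yx; rewrite addrCA subrr addr0 -fx distrC => /le_lt_trans; apply.
rewrite (_ : _ * 2 = K * `|y - x|); last by rewrite /K; ring.
by move: ye; rewrite ltr_pdivlMr; [have := normr_ge0 (y - x); nra|lra].
Unshelve. all: by end_near. Qed.

End classes.

(** The approximants are bounded and belong to all the classes considered, and
    the upper bound passes to subclasses.  Hence each class and its bounded part
    are treated at once. *)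
Section sc_classes.
Variables (R : realType) (W : Type).
Hypothesis omega1W : is_omega1 W.
Implicit Type F : set (R -> R).

Lemma sc_omega1 F :
  countably_separated F -> (forall n, F (@approximant R n)) ->
  ~ solvable_in F (@translation_system R) ->
  is_sc F W /\ is_sc (F `&` @bounded_functions R) W.
Proof.
move=> sepF FT nS.
have scG G : G `<=` F -> (forall n, G (@approximant R n)) -> is_sc G W.
  move=> GF GT; apply: is_sc_omega1 omega1W _ (@translation_system_difference R) _ _.
  - exact: countably_separated_sub sepF.
  - move=> S' S'S /(finite_translation_system_solvable S'S)[N solN].
    by exists (approximant N).
  - by move=> [f /GF Ff solf]; apply: nS; exists f.
split; first exact: scG.
by apply: scG => [f []//|n]; split; [exact: FT|exact: cos_sum_bounded].
Qed.

Lemma sc_omega1_approximately_continuous F :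
  F `<=` @approximately_continuous_functions R ->
  (forall n, F (@approximant R n)) ->
  is_sc F W /\ is_sc (F `&` @bounded_functions R) W.
Proof.
move=> Fac FT; apply: sc_omega1 => //.
  exact: countably_separated_sub Fac (@approximately_continuous_countably_separated R).
move=> [f /Fac acf solf].
by apply: (@translation_system_approximately_continuous R); exists f.
Qed.

Lemma sc_omega1_continuous F :
  F `<=` @continuous_functions R -> (forall n, F (@approximant R n)) ->
  is_sc F W /\ is_sc (F `&` @bounded_functions R) W.
Proof.
move=> Fc; apply: sc_omega1_approximately_continuous => f /Fc.
exact: continuous_approximately_continuous.
Qed.

End sc_classes.

Theorem corollary5p5 (R : realType) :
  exists2 omega1 : Type, is_omega1 omega1 &
    forall F : set (R -> R),
      [\/ F = @trig_polynomials R,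
          F = @continuous_functions R,
          F = @lipschitz_functions R |
          exists2 n : nat, (0 < n)%N & F = @C_ R n] \/
      [\/ F = @C_infty R,
          F = @real_analytic_functions R,
          F = @derivatives R |
          F = @approximately_continuous_functions R] ->
      is_sc F omega1 /\ is_sc (F `&` @bounded_functions R) omega1.
Proof.
have [W oW] := exists_omega1; exists W => // F.
move=> [[->|->|->|[n _ ->]]|[->|->|->|->]].
- apply: (sc_omega1_continuous oW); last exact: approximant_trig.
  exact: trig_polynomial_continuous.
- by apply: (sc_omega1_continuous oW) => // n; exact: cos_sum_continuous.
- apply: (sc_omega1_continuous oW) => [|n]; first exact: lipschitz_continuous.
  exact: cos_sum_lipschitz.
- apply: (sc_omega1_continuous oW) => [|k]; first exact: C_continuous.
  exact: cos_sum_C_infty.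
- apply: (sc_omega1_continuous oW) => [f /(_ 0%N)/C_continuous//|n].
  exact: cos_sum_C_infty.
- apply: (sc_omega1_continuous oW) => [|n]; first exact: real_analytic_continuous.
  exact: cos_sum_analytic.
- apply: (sc_omega1 oW); first exact: derivatives_countably_separated.
    exact: approximant_derivative.
  exact: translation_system_derivatives.
- apply: (sc_omega1_approximately_continuous oW) => // n.
  by apply: continuous_approximately_continuous; exact: cos_sum_continuous.
Qed.
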